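(* Let $f\in S_2$ be a cusp form of weight $2$ with Fourier expansion $f(\tau)=\sum_{n\ge1}a_n e^{2\pi i n\tau}$, and let $$H_f(z)=\int_0^{+\infty}\Phi_f(u)\sinh(zu)\,du,\qquad \Phi_f(u)=2e^{2u}\sum_{n=1}^{+\infty}a_ne^{-2\pi ne^u}.$$ Then $\Phi_f$ is an even function.
   Context: $S_2$ denotes the space of cusp forms of weight $2$ for the full modular group $\mathbf{SL}_2(\mathbb{Z})$. $\Phi_f$ is regarded as a function of $u\in\mathbb{R}$. In the paper $H_f(z)=\xi_f(1+z)$ with $\xi_f(s)=(2\pi)^{-s}\Gamma(s)L(f;s)$, where $L(f;s)=\sum_{n\ge1}a_nn^{-s}$ is the Hecke $L$-function of $f$ (analytically continued to $\mathbb{C}$). *)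

(* Defs.v *)
From Stdlib Require Import Reals ZArith.
From Coquelicot Require Import Coquelicot.

Open Scope C_scope.

Definition Cexp (z : C) : C :=
  (exp (Re z) * cos (Im z), exp (Re z) * sin (Im z))%R.

Definition Csinh (z : C) : C := (Cexp z - Cexp (- z)) / 2.

(* Functions on the upper half-plane are total functions on [C]; only their
   values at points of [upper_half] are ever constrained. *)
Definition upper_half (tau : C) : Prop := (0 < Im tau)%R.

(* [ex_derive] is taken over the field [C]: this is complex differentiability. *)
Definition holomorphic_on_upper_half (f : C -> C) : Prop :=
  forall tau : C, upper_half tau ->
    @ex_derive C_AbsRing C_NormedModule f tau.

(* Covariance of weight [k] under the full modular group SL_2(Z), whose
   elements are given by their four integer entries. *)
Definition weakly_modular (k : nat) (f : C -> C) : Prop :=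
  forall a b c d : Z, (a * d - b * c = 1)%Z ->
  forall tau : C, upper_half tau ->
    f ((IZR a * tau + IZR b) / (IZR c * tau + IZR d)) =
    (IZR c * tau + IZR d) ^ k * f tau.

(* f(tau) = sum_{n >= 1} a_n e^{2 pi i n tau} on the upper half-plane.
   Coquelicot series start at 0, hence the shift; [a 0] is never used. *)
Definition cuspidal_fourier_expansion (f : C -> C) (a : nat -> C) : Prop :=
  forall tau : C, upper_half tau ->
    is_series (K := C_AbsRing) (V := C_NormedModule)
      (fun n => a (S n) * Cexp (2 * PI * Ci * INR (S n) * tau)) (f tau).

(* The space S_k of cusp forms of weight [k] for SL_2(Z). *)
Definition cusp_form (k : nat) (f : C -> C) : Prop :=
  holomorphic_on_upper_half f /\
  weakly_modular k f /\
  exists a : nat -> C, cuspidal_fourier_expansion f a.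

(* Sum of a complex series; as for [RInt_gen], the value is meaningful only
   when the series converges. *)
Definition CSeries (a : nat -> C) : C :=
  iota (T := C_CompleteNormedModule)
    (is_series (K := C_AbsRing) (V := C_NormedModule) a).

Definition Phi (a : nat -> C) (u : R) : C :=
  2 * exp (2 * u) *
  CSeries (fun n => a (S n) * exp (- 2 * PI * INR (S n) * exp u)).

Definition is_even (g : R -> C) : Prop := forall u : R, g (- u)%R = g u.

(* Main.v *)
Require Import Defs.
From Stdlib Require Import Reals.
From Coquelicot Require Import Coquelicot.
From Stdlib Require Import Lra Lia.

Local Open Scope C_scope.

(** The function [Phi a u] equals [2 e^{2u} f(i e^u)] ([Phi_eq]).  The
    transformation [f(-1/tau) = tau^2 f(tau)] at [tau = i e^u] turns this into
    [Phi a (-u) = - 2 f(i e^u)], so evenness forces [f] to vanish on the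
    imaginary axis: the statement holds because there is no nonzero cusp form
    of weight 2 ([cusp_form_weight_2_zero]).

    The vanishing is obtained without contour integrals, by a contraction
    argument on the function [g(tau) = Im tau * |f tau|], which is invariant
    under SL_2(Z) since the weight is 2.
    - Every orbit meets the half-plane [Im tau >= 1/2], so a bound of [g] there
      is a bound everywhere ([modular_bound]).  On that half-plane the Fourier
      expansion bounds [g] by [1/2 sum_n |a_n| e^{-pi n}] ([cusp_bound]); in
      particular [g] is bounded ([cusp_form_bounded]).
    - If [g <= B], Cauchy's estimate on the line [Im tau = 1/(2 pi n)] yields
      Hecke's bound [|a_n| <= 2 pi e n B] ([hecke_bound]).
    - Feeding this into the previous bound yields
      [g <= pi e B sum_n n e^{-pi n}], and the factor of [B] is smaller than 1
      because [e^{-pi}] is small; crude estimates give [6/7]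
      ([bound_contracts]).  Iterating, [g = 0].

    Cauchy's estimate itself ([cauchy_estimate]) is proved by averaging over
    roots of unity. *)

(* Equalities at the carrier of [C_NormedModule] are equalities in [C]; [ring]
   has to be told so. *)
Ltac cring := match goal with |- ?x = ?y => change (@eq C x y) end; ring.

(** * Series *)

(** Comparison of a complex series with a real majorant. *)
Lemma is_series_Cmod_le (c : nat -> C) (l : C) (b : nat -> R) (s : R) :
  is_series (K := C_AbsRing) (V := C_NormedModule) c l ->
  (forall n, Cmod (c n) <= b n)%R ->
  is_series b s -> (Cmod l <= s)%R.
Proof.
  intros Hc Hcb Hb.
  assert (Hn : is_lim_seq
      (fun n => norm (sum_n (G := C_NormedModule) c n)) (Cmod l)).
  { apply (filterlim_comp _ _ _ (sum_n (G := C_NormedModule) c) norm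
             eventually (locally l)); [exact Hc|].
    exact (filterlim_norm (V := C_NormedModule) l). }
  refine (is_lim_seq_le _ _ (Finite (Cmod l)) (Finite s) _ Hn Hb).
  intros n. unfold sum_n.
  eapply Rle_trans; [apply (norm_sum_n_m (V := C_NormedModule))|].
  apply sum_n_m_le. exact Hcb.
Qed.

Lemma is_series_terms_bounded (c : nat -> C) (l : C) :
  is_series (K := C_AbsRing) (V := C_NormedModule) c l ->
  exists M : R, forall n, (Cmod (c n) <= M)%R.
Proof.
  intros Hc.
  destruct (filterlim_bounded (V := C_NormedModule)
              (sum_n (G := C_NormedModule) c)) as [M HM].
  { exists l. exact Hc. }
  exists (M + M)%R. intros n.
  assert (HM' : forall k, (Cmod (sum_n (G := C_NormedModule) c k) <= M)%R)
    by exact HM.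
  assert (HM0 : (0 <= M)%R) by (eapply Rle_trans; [apply Cmod_ge_0|apply (HM' O)]).
  destruct n as [|n].
  - generalize (HM' O). rewrite sum_O. lra.
  - assert (E : c (S n) = (sum_n (G := C_NormedModule) c (S n)
                          - sum_n (G := C_NormedModule) c n)%C).
    { rewrite sum_Sn. change plus with Cplus. ring. }
    rewrite E. unfold Cminus.
    eapply Rle_trans; [apply Cmod_triangle|]. rewrite Cmod_opp.
    apply Rplus_le_compat; apply HM'.
Qed.

Lemma is_series_scal_geom (x q : R) :
  (0 <= q < 1)%R -> is_series (fun n => x * q ^ n)%R (x * / (1 - q))%R.
Proof.
  intros Hq. apply (is_series_scal (V := R_NormedModule) x (fun n => q ^ n)%R).
  apply is_series_geom. rewrite Rabs_pos_eq; lra.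
Qed.

Lemma is_series_single (n : nat) (x : C) :
  is_series (K := C_AbsRing) (V := C_NormedModule)
    (fun m => if Nat.eqb m n then x else RtoC 0) x.
Proof.
  assert (E : forall M, sum_n (G := C_NormedModule)
                (fun m => if Nat.eqb m n then x else RtoC 0) M
              = if Nat.leb n M then x else RtoC 0).
  { induction M as [|M IH].
    - rewrite sum_O. destruct n; reflexivity.
    - rewrite sum_Sn, IH. change plus with Cplus.
      destruct (Nat.eqb_spec (S M) n); destruct (Nat.leb_spec n M);
        destruct (Nat.leb_spec n (S M)); try lia; cring. }
  apply (filterlim_ext_loc (fun _ => x)); [|apply filterlim_const].
  exists n. intros M HM. rewrite E.
  destruct (Nat.leb_spec n M); [reflexivity|lia].
Qed.

(** * Unit complex numbers and orthogonality *)

(** The point of argument [t] on the unit circle. *)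
Definition expi (t : R) : C := (cos t, sin t).

Lemma expi_plus (s t : R) : expi (s + t) = expi s * expi t.
Proof.
  unfold expi, Cmult; simpl. rewrite cos_plus, sin_plus. f_equal; ring.
Qed.

Lemma expi_0 : expi 0 = 1.
Proof. unfold expi. rewrite cos_0, sin_0. reflexivity. Qed.

Lemma Cmod_expi (t : R) : Cmod (expi t) = 1%R.
Proof.
  unfold Cmod, expi; simpl.
  replace (cos t * (cos t * 1) + sin t * (sin t * 1))%R with 1%R.
  - apply sqrt_1.
  - generalize (sin2_cos2 t). unfold Rsqr. lra.
Qed.

Lemma expi_2PI_nat (n : nat) : expi (2 * PI * INR n) = 1.
Proof.
  unfold expi.
  replace (2 * PI * INR n)%R with (0 + 2 * INR n * PI)%R by ring.
  rewrite cos_period, sin_period, cos_0, sin_0. reflexivity.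
Qed.

Lemma expi_neq_1 (t : R) : (0 < t < 2 * PI)%R -> expi t <> 1.
Proof.
  intros Ht E. apply (f_equal Re) in E. unfold expi in E; simpl in E.
  assert (Hs : (0 < sin (t / 2))%R) by (apply sin_gt_0; lra).
  replace t with (2 * (t / 2))%R in E by field.
  rewrite cos_2a_sin in E. nra.
Qed.

Lemma sum_geom_root_of_unity (w : C) (p : nat) :
  w <> 1 -> w ^ S p = 1 ->
  sum_n (G := C_NormedModule) (fun k => w ^ k) p = RtoC 0.
Proof.
  intros Hw Hp.
  assert (E : forall q, (w - 1) * sum_n (G := C_NormedModule) (fun k => w ^ k) q
                        = w ^ S q - 1).
  { induction q as [|q IH].
    - rewrite sum_O. simpl. ring.
    - rewrite sum_Sn. change plus with Cplus.
      rewrite Cmult_plus_distr_l, IH. simpl. ring. }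
  specialize (E p). rewrite Hp in E.
  destruct (Ceq_dec (sum_n (G := C_NormedModule) (fun k => w ^ k) p) (RtoC 0))
    as [H|H]; [exact H|exfalso].
  assert (Hw1 : w - 1 <> 0).
  { intros H1. apply Hw. replace w with (w - 1 + 1) by ring. rewrite H1. ring. }
  apply (Cmult_neq_0 _ _ Hw1 H). rewrite E. ring.
Qed.

Lemma expi_INR_mult (k : nat) (t : R) : expi (INR k * t) = expi t ^ k.
Proof.
  induction k as [|k IH].
  - simpl. rewrite Rmult_0_l. apply expi_0.
  - rewrite S_INR, Rmult_plus_distr_r, Rmult_1_l, Rplus_comm, expi_plus, IH.
    reflexivity.
Qed.

Lemma sum_expi_orthogonal (p m n : nat) :
  (m <= p)%nat -> (n <= p)%nat -> m <> n ->
  sum_n (G := C_NormedModule)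
    (fun k => expi (INR m * (2 * PI * INR k / INR (S p)))
              * expi (- (INR n * (2 * PI * INR k / INR (S p))))) p = RtoC 0.
Proof.
  intros Hm Hn Hmn.
  assert (HN : (0 < INR (S p))%R) by (apply lt_0_INR; lia).
  assert (Hmp : (INR m < INR (S p))%R) by (apply lt_INR; lia).
  assert (Hnp : (INR n < INR (S p))%R) by (apply lt_INR; lia).
  assert (Hm0 := pos_INR m). assert (Hn0 := pos_INR n).
  assert (HPI := PI_RGT_0).
  set (t := ((INR m - INR n) * (2 * PI) / INR (S p))%R).
  rewrite (sum_n_ext _ (fun k => expi t ^ k)).
  2:{ intros k. rewrite <- expi_plus, <- expi_INR_mult. f_equal.
      unfold t. field. lra. }
  apply sum_geom_root_of_unity.
  - assert (Hq : forall u v, (0 <= v)%R -> (v < u)%R -> (u < INR (S p))%R ->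
        expi ((u - v) * (2 * PI) / INR (S p)) <> 1).
    { intros u v Hv Huv Hu. apply expi_neq_1.
      replace ((u - v) * (2 * PI) / INR (S p))%R
        with ((u - v) / INR (S p) * (2 * PI))%R by (field; lra).
      assert (0 < (u - v) / INR (S p) < 1)%R.
      { split; [apply Rdiv_lt_0_compat; lra|].
        apply Rmult_lt_reg_r with (INR (S p)); [lra|].
        unfold Rdiv. rewrite Rmult_assoc, Rinv_l, Rmult_1_r; lra. }
      split; nra. }
    destruct (Rtotal_order (INR m) (INR n)) as [H|[H|H]].
    + intros E. apply (Hq (INR n) (INR m)); try assumption.
      replace ((INR n - INR m) * (2 * PI) / INR (S p))%R with (- t)%R
        by (unfold t; field; lra).
      replace (expi (- t)) with (expi t * expi (- t)) by (rewrite E; ring).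
      rewrite <- expi_plus, Rplus_opp_r. apply expi_0.
    + apply INR_eq in H. contradiction.
    + apply (Hq (INR m) (INR n)); assumption.
  - rewrite <- expi_INR_mult.
    replace (INR (S p) * t)%R with (2 * PI * INR m + - (2 * PI * INR n))%R
      by (unfold t; field; lra).
    rewrite expi_plus, expi_2PI_nat, <- (expi_2PI_nat n) at 1.
    rewrite <- expi_plus, Rplus_opp_r. apply expi_0.
Qed.

(** * Cauchy's estimate *)

Lemma is_series_sum_n (c : nat -> nat -> C) (l : nat -> C) (p : nat) :
  (forall k, is_series (K := C_AbsRing) (V := C_NormedModule) (c k) (l k)) ->
  is_series (K := C_AbsRing) (V := C_NormedModule)
    (fun m => sum_n (G := C_NormedModule) (fun k => c k m) p)
    (sum_n (G := C_NormedModule) l p).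
Proof.
  intros Hc. induction p as [|p IH].
  - rewrite sum_O. apply (is_series_ext (c O)); [|apply Hc].
    intros m. rewrite sum_O. reflexivity.
  - rewrite sum_Sn.
    apply (is_series_ext (fun m => plus
      (sum_n (G := C_NormedModule) (fun k => c k m) p) (c (S p) m))).
    + intros m. rewrite sum_Sn. reflexivity.
    + apply (is_series_plus (V := C_NormedModule)); [exact IH|apply Hc].
Qed.

Lemma Cmod_sum_n_le (u : nat -> C) (M : R) (p : nat) :
  (forall k, (k <= p)%nat -> Cmod (u k) <= M)%R ->
  (Cmod (sum_n (G := C_NormedModule) u p) <= INR (S p) * M)%R.
Proof.
  induction p as [|p IH]; intros Hu.
  - rewrite sum_O. simpl. rewrite Rmult_1_l. apply Hu. lia.
  - rewrite sum_Sn, S_INR, Rmult_plus_distr_r, Rmult_1_l.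
    eapply Rle_trans; [apply Cmod_triangle|].
    apply Rplus_le_compat; [apply IH; intros; apply Hu; lia|apply Hu; lia].
Qed.

(** Cauchy's estimate: if [F t = sum_m c_m e^{i m t}] is bounded by [M], so is
    every coefficient.  The coefficients are assumed to decay geometrically,
    with a ratio written [s^2]: splitting [s^{2m}] as [s^m s^m] bounds the
    terms [m > p] by [K s^{p+1} s^m], a multiple of one fixed geometric
    series. *)
Lemma cauchy_estimate (c : nat -> C) (F : R -> C) (M K s : R) :
  (0 <= s < 1)%R ->
  (forall m, Cmod (c m) <= K * (s ^ m * s ^ m))%R ->
  (forall t, is_series (K := C_AbsRing) (V := C_NormedModule)
               (fun m => c m * expi (INR m * t)) (F t)) ->
  (forall t, Cmod (F t) <= M)%R ->
  forall n, (Cmod (c n) <= M)%R.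
Proof.
  intros Hs Hc HF HM n.
  assert (HK : (0 <= K)%R).
  { generalize (Hc O) (Cmod_ge_0 (c O)). simpl. lra. }
  (* Averaging [e^{-i n t} F t] over the [p + 1] points [t = 2 pi k / (p + 1)]
     cancels the coefficients of index [m <= p] other than [n]; those of index
     [m > p] contribute an error that tends to 0 with [p]. *)
  assert (Hp : forall p, (n <= p)%nat ->
             (Cmod (c n) <= M + K / (1 - s) * s ^ S p)%R).
  { intros p Hnp.
    set (N := INR (S p)).
    assert (HN : (0 < N)%R) by (apply lt_0_INR; lia).
    set (t := fun k : nat => (2 * PI * INR k / N)%R).
    set (A := (sum_n (G := C_NormedModule)
                (fun k => expi (- (INR n * t k)) * F (t k)) p) : C).
    set (d := fun m => (sum_n (G := C_NormedModule)
                (fun k => expi (- (INR n * t k))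
                          * (c m * expi (INR m * t k))) p) : C).
    assert (HA : is_series (K := C_AbsRing) (V := C_NormedModule) d A).
    { apply (is_series_sum_n
        (fun k m => expi (- (INR n * t k)) * (c m * expi (INR m * t k)))).
      intros k.
      exact (is_series_scal (V := C_NormedModule) (expi (- (INR n * t k)))
               _ _ (HF (t k))). }
    assert (HdE : forall m, d m = c m * sum_n (G := C_NormedModule)
              (fun k => expi (INR m * t k) * expi (- (INR n * t k))) p).
    { intros m. unfold d.
      rewrite <- (sum_n_mult_l (K := C_Ring) (c m)
        (fun k => expi (INR m * t k) * expi (- (INR n * t k)))).
      apply (sum_n_ext (G := C_NormedModule)). intros k.
      change mult with Cmult. cring. }
    assert (Hdn : d n = N * c n).
    { rewrite HdE, Cmult_comm. f_equal.
      rewrite (sum_n_ext (G := C_NormedModule) _ (fun _ => RtoC 1)).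
      - unfold N. clear. induction p as [|p IH].
        + rewrite sum_O. reflexivity.
        + rewrite sum_Sn, IH, (S_INR (S p)), RtoC_plus. reflexivity.
      - intros k. rewrite <- expi_plus, Rplus_opp_r. apply expi_0. }
    assert (Hd0 : forall m, (m <= p)%nat -> m <> n -> d m = 0).
    { intros m Hm Hmn. rewrite HdE. unfold t, N.
      rewrite sum_expi_orthogonal by assumption. ring. }
    assert (Hdle : forall m, (Cmod (d m) <= N * Cmod (c m))%R).
    { intros m. apply Cmod_sum_n_le. intros k _.
      rewrite !Cmod_mult, !Cmod_expi. lra. }
    assert (Hdiff : is_series (K := C_AbsRing) (V := C_NormedModule)
              (fun m => d m - (if Nat.eqb m n then N * c n else RtoC 0))
              (A - N * c n))
      by exact (is_series_minus (V := C_NormedModule) _ _ _ _ HA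
                  (is_series_single n (N * c n))).
    assert (HAN : (Cmod (A - N * c n) <= N * K * s ^ S p * / (1 - s))%R).
    { refine (is_series_Cmod_le _ _ (fun m => N * K * s ^ S p * s ^ m)%R _
                Hdiff _ _).
      - intros m.
        assert (Hpos : (0 <= N * K * s ^ S p * s ^ m)%R).
        { repeat apply Rmult_le_pos; try apply pow_le; lra. }
        destruct (Nat.eqb_spec m n) as [->|Hmn].
        + rewrite Hdn. replace (N * c n - N * c n) with (RtoC 0) by ring.
          rewrite Cmod_0. exact Hpos.
        + replace (d m - 0) with (d m) by ring.
          destruct (Nat.le_gt_cases m p) as [Hm|Hm].
          * rewrite Hd0, Cmod_0 by assumption. exact Hpos.
          * eapply Rle_trans; [apply Hdle|].
            rewrite !Rmult_assoc.
            apply Rmult_le_compat_l; [lra|].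
            eapply Rle_trans; [apply Hc|].
            apply Rmult_le_compat_l; [exact HK|].
            apply Rmult_le_compat_r; [apply pow_le; lra|].
            replace m with (S p + (m - S p))%nat by lia.
            rewrite pow_add.
            rewrite <- (Rmult_1_r (s ^ S p)) at 2.
            apply Rmult_le_compat_l; [apply pow_le; lra|].
            rewrite <- (pow1 (m - S p)). apply pow_incr. lra.
      - apply is_series_scal_geom. lra. }
    assert (HAM : (Cmod A <= N * M)%R).
    { apply Cmod_sum_n_le. intros k _.
      rewrite Cmod_mult, Cmod_expi, Rmult_1_l. apply HM. }
    assert (HNc : (N * Cmod (c n)
                   <= N * M + N * K * s ^ S p * / (1 - s))%R).
    { replace (N * Cmod (c n))%R with (Cmod (N * c n))
        by (rewrite Cmod_mult, Cmod_R, Rabs_pos_eq; lra).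
      replace (N * c n) with (A + - (A - N * c n)) by ring.
      eapply Rle_trans; [apply Cmod_triangle|]. rewrite Cmod_opp. lra. }
    apply Rmult_le_reg_l with N; [exact HN|].
    eapply Rle_trans; [exact HNc|]. right. field. lra. }
  assert (Hlim : is_lim_seq (fun p => M + K / (1 - s) * s ^ S p)%R
                             (M + K / (1 - s) * 0)%R).
  { apply is_lim_seq_plus'; [apply is_lim_seq_const|].
    apply (is_lim_seq_scal_l (fun p => s ^ S p)%R _ 0%R).
    apply (is_lim_seq_incr_1 (fun p => s ^ p)%R).
    apply is_lim_seq_geom. rewrite Rabs_pos_eq; lra. }
  rewrite Rmult_0_r, Rplus_0_r in Hlim.
  refine (is_lim_seq_le_loc (fun _ => Cmod (c n)) _ (Finite (Cmod (c n)))
            (Finite M) _ (is_lim_seq_const _) Hlim).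
  exists n. exact Hp.
Qed.

(** * Fourier expansions on the upper half-plane *)

Lemma Cexp_fourier (n : nat) (tau : C) :
  Cexp (2 * PI * Ci * INR n * tau)
  = exp (- (2 * PI * INR n * Im tau)) * expi (INR n * (2 * PI * Re tau)).
Proof.
  replace (2 * PI * Ci * INR n * tau)
    with (- (2 * PI * INR n * Im tau), INR n * (2 * PI * Re tau))%R.
  - unfold Cexp, expi, Cmult. simpl Re. simpl Im.
    apply injective_projections; simpl; ring.
  - destruct tau as [x y]. apply injective_projections; simpl; ring.
Qed.

Lemma fourier_terms_bounded (f : C -> C) (a : nat -> C) (y : R) :
  cuspidal_fourier_expansion f a -> (0 < y)%R ->
  exists K, forall n,
    (Cmod (a (S n)) * exp (- (2 * PI * INR (S n) * y)) <= K)%R.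
Proof.
  intros ha Hy.
  destruct (is_series_terms_bounded _ _ (ha (0%R, y) Hy)) as [K HK].
  exists K. intros n. specialize (HK n).
  rewrite Cexp_fourier, !Cmod_mult, Cmod_expi, Cmod_R, Rabs_pos_eq in HK
    by (apply Rlt_le, exp_pos).
  simpl Im in HK. lra.
Qed.

Lemma exp_INR_mult (n : nat) (t : R) : exp (INR n * t) = (exp t ^ n)%R.
Proof.
  induction n as [|n IH].
  - simpl. rewrite Rmult_0_l. apply exp_0.
  - rewrite S_INR, Rmult_plus_distr_r, Rmult_1_l, exp_plus, IH. simpl. ring.
Qed.

Lemma exp_le (s t : R) : (s <= t)%R -> (exp s <= exp t)%R.
Proof. intros [H| ->]; [left; apply exp_increasing, H|right; reflexivity]. Qed.

Lemma exp_lt_1 (t : R) : (t < 0)%R -> (0 < exp t < 1)%R.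
Proof.
  intros Ht. split; [apply exp_pos|]. rewrite <- exp_0. apply exp_increasing, Ht.
Qed.

(** Cauchy's estimate on the horizontal line of height [y].  Convergence of the
    expansion at height [y / 2] provides the geometric decay. *)
Lemma fourier_coeff_bound (f : C -> C) (a : nat -> C) (y M : R) :
  cuspidal_fourier_expansion f a -> (0 < y)%R ->
  (forall x : R, Cmod (f (x, y)) <= M)%R ->
  forall n, (Cmod (a (S n)) * exp (- (2 * PI * INR (S n) * y)) <= M)%R.
Proof.
  intros ha Hy HM n.
  assert (HPI := PI_RGT_0).
  destruct (fourier_terms_bounded f a (y / 2) ha) as [K HK]; [lra|].
  assert (HK0 : (0 <= K)%R).
  { eapply Rle_trans; [|apply (HK O)].
    apply Rmult_le_pos; [apply Cmod_ge_0|apply Rlt_le, exp_pos]. }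
  set (c := fun m => a (S m) * exp (- (2 * PI * INR (S m) * y))).
  assert (Hcm : forall m, Cmod (c m)
            = (Cmod (a (S m)) * exp (- (2 * PI * INR (S m) * y)))%R).
  { intros m. unfold c. rewrite Cmod_mult, Cmod_R, Rabs_pos_eq; [reflexivity|].
    apply Rlt_le, exp_pos. }
  rewrite <- Hcm.
  assert (Hs : (0 < exp (- (PI * y / 2)) < 1)%R)
    by (apply exp_lt_1; nra).
  (* The factor [expi (- t)] shifts the frequencies, which start at 1 in the
     Fourier expansion and at 0 in Cauchy's estimate. *)
  apply (cauchy_estimate c
    (fun t => expi (- t) * f ((t / (2 * PI))%R, y)) M K (exp (- (PI * y / 2)))).
  - lra.
  - intros m. rewrite Hcm, <- !exp_INR_mult, <- exp_plus.
    replace (- (2 * PI * INR (S m) * y))%R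
      with (- (2 * PI * INR (S m) * (y / 2))
            + - (PI * INR (S m) * y))%R by field.
    rewrite exp_plus, <- Rmult_assoc.
    apply Rmult_le_compat;
      [apply Rmult_le_pos; [apply Cmod_ge_0|apply Rlt_le, exp_pos]
      |apply Rlt_le, exp_pos|apply HK|].
    apply exp_le. rewrite S_INR. nra.
  - intros t.
    apply (is_series_ext (fun m => scal (V := C_NormedModule) (expi (- t))
      (a (S m) * Cexp (2 * PI * Ci * INR (S m) * ((t / (2 * PI))%R, y))))).
    + intros m. change scal with Cmult. rewrite Cexp_fourier.
      unfold c. simpl Im. simpl Re.
      replace (INR (S m) * (2 * PI * (t / (2 * PI))))%R with (t + INR m * t)%R
        by (rewrite S_INR; field; lra).
      rewrite expi_plus.
      replace (expi (INR m * t)) with (expi (- t + t) * expi (INR m * t)) at 2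
        by (rewrite Rplus_opp_l, expi_0; ring).
      rewrite expi_plus. cring.
    + apply (is_series_scal (V := C_NormedModule)). apply ha. exact Hy.
  - intros t. rewrite Cmod_mult, Cmod_expi, Rmult_1_l. apply HM.
Qed.

(** * Reduction to the half-plane Im tau >= 1/2 *)

Lemma weakly_modular_translate (k : nat) (f : C -> C) (b : Z) (tau : C) :
  weakly_modular k f -> upper_half tau -> f (tau + IZR b) = f tau.
Proof.
  intros hf Ht.
  assert (E := hf 1%Z b 0%Z 1%Z ltac:(ring) tau Ht).
  replace ((1 * tau + IZR b) / (0 * tau + 1)) with (tau + IZR b) in E
    by (field; intros H; apply (f_equal Re) in H; simpl in H; lra).
  rewrite E. replace (0 * tau + 1) with (RtoC 1) by ring.
  rewrite Cpow_1_l. ring.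
Qed.

Lemma upper_half_neq_0 (tau : C) : upper_half tau -> tau <> 0.
Proof. intros Ht ->. unfold upper_half in Ht. simpl in Ht. lra. Qed.

Lemma weakly_modular_invert (k : nat) (f : C -> C) (tau : C) :
  weakly_modular k f -> upper_half tau -> f (- / tau) = tau ^ k * f tau.
Proof.
  intros hf Ht.
  assert (E := hf 0%Z (-1)%Z 1%Z 0%Z ltac:(ring) tau Ht).
  assert (H0 := upper_half_neq_0 tau Ht).
  replace ((0 * tau + -1) / (1 * tau + 0)) with (- / tau) in E
    by (field; exact H0).
  rewrite E. f_equal. f_equal. ring.
Qed.

Lemma Im_opp_inv (tau : C) : Im (- / tau) = (Im tau / Cmod tau ^ 2)%R.
Proof.
  rewrite Cmod2_alt. destruct tau as [x y]. simpl. unfold Rdiv. ring.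
Qed.

(** A bound of the invariant function [Im tau * |f tau|] on [Im tau >= 1/2]
    holds on the whole upper half-plane. *)
Lemma modular_bound (f : C -> C) (B : R) :
  weakly_modular 2 f ->
  (forall tau, (1 / 2 <= Im tau)%R -> (Im tau * Cmod (f tau) <= B)%R) ->
  forall tau, upper_half tau -> (Im tau * Cmod (f tau) <= B)%R.
Proof.
  intros hf HB.
  (* If [Im tau < 1/2], translate [tau] to [sigma] with [|Re sigma| <= 1/2];
     then [|sigma|^2 <= 1/2], so [- 1 / sigma] has at least twice the imaginary
     part of [tau]. *)
  assert (Hn : forall n tau, ((1 / 2) ^ S n <= Im tau)%R ->
             (Im tau * Cmod (f tau) <= B)%R).
  { induction n as [|n IH]; intros tau Ht.
    - apply HB. simpl in Ht. lra.
    - assert (Hpow : (0 < (1 / 2) ^ S n)%R) by (apply pow_lt; lra).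
      change ((1 / 2) ^ S (S n))%R with (1 / 2 * (1 / 2) ^ S n)%R in Ht.
      assert (Hup : upper_half tau) by (unfold upper_half; lra).
      destruct (Rle_lt_dec (1 / 2) (Im tau)) as [Hy|Hy]; [apply HB, Hy|].
      set (b := (- up (Re tau - 1 / 2))%Z).
      set (sigma := tau + IZR b).
      assert (Him : Im sigma = Im tau) by (unfold sigma, Im; simpl; ring).
      assert (Hups : upper_half sigma)
        by (unfold upper_half; rewrite Him; exact Hup).
      assert (Hre : (- (1 / 2) <= Re sigma <= 1 / 2)%R).
      { unfold sigma, b. simpl. rewrite opp_IZR.
        destruct (archimed (Re tau - 1 / 2)) as [H1 H2].
        change (fst tau) with (Re tau). lra. }
      assert (H0 : (0 < Cmod sigma)%R)
        by (apply Cmod_gt_0, upper_half_neq_0, Hups).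
      assert (Hsq : (Cmod sigma ^ 2 <= 1 / 2)%R).
      { rewrite Cmod2_alt, Him. unfold upper_half in Hup. nra. }
      assert (Hsq0 : (0 < Cmod sigma ^ 2)%R) by (apply pow_lt, H0).
      assert (Hg : (Im (- / sigma)%C * Cmod (f (- / sigma)%C)
                    = Im tau * Cmod (f tau))%R).
      { rewrite Im_opp_inv, (weakly_modular_invert 2 f sigma hf Hups), Him.
        rewrite Cmod_mult, Cmod_pow.
        unfold sigma at 3. rewrite (weakly_modular_translate 2 f b tau hf Hup).
        field. lra. }
      rewrite <- Hg. apply IH. rewrite Im_opp_inv, Him.
      apply Rmult_le_reg_r with (Cmod sigma ^ 2)%R; [exact Hsq0|].
      replace (Im tau / Cmod sigma ^ 2 * Cmod sigma ^ 2)%R with (Im tau)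
        by (field; lra).
      nra. }
  intros tau Ht.
  destruct (pow_lt_1_zero (1 / 2) ltac:(rewrite Rabs_pos_eq; lra) (Im tau) Ht)
    as [n Hnn].
  apply (Hn n). specialize (Hnn (S n) ltac:(lia)).
  rewrite Rabs_pos_eq in Hnn by (apply pow_le; lra). lra.
Qed.

(** * Vanishing of cusp forms of weight 2 *)

(** The function [y e^{-2 pi m y}] decreases for [y >= 1/2], where [m >= 1]. *)
Lemma mult_exp_le_half (n : nat) (y : R) : (1 / 2 <= y)%R ->
  (y * exp (- (2 * PI * INR (S n) * y)) <= 1 / 2 * exp (- (PI * INR (S n))))%R.
Proof.
  intros Hy.
  assert (HPI : (3 < PI)%R) by (generalize PI2_3_2; lra).
  assert (Hn := pos_INR n).
  (* [e^{-2 pi m y} = e^{-pi m} e^{-x}], and [e^x >= 1 + x >= 2 y]. *)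
  set (x := (PI * INR (S n) * (2 * y - 1))%R).
  assert (Hx : (2 * y - 1 <= x)%R).
  { assert (H1 : (1 <= PI * INR (S n))%R) by (rewrite S_INR; nra).
    unfold x. nra. }
  replace (- (2 * PI * INR (S n) * y))%R with (- (PI * INR (S n)) + - x)%R
    by (unfold x; ring).
  rewrite exp_plus, (exp_Ropp x).
  assert (Hex : (2 * y <= exp x)%R) by (generalize (exp_ineq1_le x); lra).
  assert (Hp := exp_pos (- (PI * INR (S n)))).
  assert (Hq : (y * / exp x <= 1 / 2)%R).
  { apply Rmult_le_reg_r with (exp x); [apply exp_pos|].
    rewrite Rmult_assoc, Rinv_l by (apply Rgt_not_eq, exp_pos). lra. }
  apply (Rmult_le_compat_r _ _ _ (Rlt_le _ _ Hp)) in Hq. lra.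
Qed.

Lemma cusp_bound (f : C -> C) (a : nat -> C) (b : nat -> R) (s : R) :
  cuspidal_fourier_expansion f a ->
  (forall n, Cmod (a (S n)) * exp (- (PI * INR (S n))) <= b n)%R ->
  is_series b s ->
  forall tau, (1 / 2 <= Im tau)%R -> (Im tau * Cmod (f tau) <= 1 / 2 * s)%R.
Proof.
  intros ha Hb Hs tau Ht.
  assert (Hup : upper_half tau) by (unfold upper_half; lra).
  replace (Im tau * Cmod (f tau))%R with (Cmod (Im tau * f tau))
    by (rewrite Cmod_mult, Cmod_R, Rabs_pos_eq; lra).
  refine (is_series_Cmod_le _ _ _ _
    (is_series_scal (V := C_NormedModule) (RtoC (Im tau)) _ _ (ha tau Hup)) _
    (is_series_scal (V := R_NormedModule) (1 / 2)%R _ _ Hs)).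
  intros n.
  change (Cmod (Im tau * (a (S n) * Cexp (2 * PI * Ci * INR (S n) * tau)))
          <= 1 / 2 * b n)%R.
  rewrite Cexp_fourier, !Cmod_mult, Cmod_expi, !Cmod_R.
  rewrite !Rabs_pos_eq by (try apply Rlt_le, exp_pos; lra).
  assert (H1 := mult_exp_le_half n (Im tau) Ht).
  assert (H2 := Cmod_ge_0 (a (S n))).
  specialize (Hb n). nra.
Qed.

Lemma exp_opp_PI_le : (exp (- PI) <= 1 / 16)%R.
Proof.
  assert (HPI : (3 < PI)%R) by (generalize PI2_3_2; lra).
  assert (H : (16 <= exp PI)%R).
  (* [e^pi >= (e^{1/10})^30 >= (11/10)^30 >= 16]. *)
  { apply Rle_trans with (exp (INR 30 * / 10)).
    - rewrite exp_INR_mult. apply Rle_trans with ((11 / 10) ^ 30)%R; [lra|].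
      apply pow_incr. split; [lra|]. generalize (exp_ineq1_le (/ 10)); lra.
    - apply exp_le. simpl. lra. }
  rewrite exp_Ropp. unfold Rdiv. rewrite Rmult_1_l.
  apply Rinv_le_contravar; lra.
Qed.

(** Hecke's bound on the Fourier coefficients in weight 2, from Cauchy's
    estimate at the height [1 / (2 pi n)], which is optimal. *)
Lemma hecke_bound (f : C -> C) (a : nat -> C) (B : R) :
  cuspidal_fourier_expansion f a ->
  (forall tau, upper_half tau -> Im tau * Cmod (f tau) <= B)%R ->
  forall n, (Cmod (a (S n)) <= 2 * PI * exp 1 * INR (S n) * B)%R.
Proof.
  intros ha HB n.
  assert (HPI := PI_RGT_0).
  assert (Hn : (0 < INR (S n))%R) by (apply lt_0_INR; lia).
  set (w := (2 * PI * INR (S n))%R).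
  assert (Hw : (0 < w)%R) by (unfold w; nra).
  assert (H := fourier_coeff_bound f a (/ w) (w * B) ha
                 (Rinv_0_lt_compat _ Hw)).
  assert (Hle : (Cmod (a (S n)) * exp (- (2 * PI * INR (S n) * / w))
                 <= w * B)%R).
  { apply H. intros x.
    assert (Hx := HB (x, (/ w)%R) (Rinv_0_lt_compat _ Hw)). simpl Im in Hx.
    apply Rmult_le_reg_l with (/ w)%R; [apply Rinv_0_lt_compat, Hw|].
    eapply Rle_trans; [exact Hx|]. right. field. lra. }
  replace (2 * PI * INR (S n) * / w)%R with 1%R in Hle
    by (unfold w; field; lra).
  rewrite exp_Ropp in Hle.
  apply Rmult_le_reg_r with (/ exp 1)%R;
    [apply Rinv_0_lt_compat, exp_pos|].
  eapply Rle_trans; [exact Hle|]. right. unfold w. field.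
  apply Rgt_not_eq, exp_pos.
Qed.

Lemma INR_S_le_pow2 (n : nat) : (INR (S n) <= 2 ^ n)%R.
Proof.
  induction n as [|n IH]; [simpl; lra|].
  assert (H : (1 <= 2 ^ n)%R) by (apply pow_R1_Rle; lra).
  rewrite S_INR. simpl (2 ^ S n)%R. lra.
Qed.

Lemma cusp_form_bounded (f : C -> C) (a : nat -> C) :
  weakly_modular 2 f -> cuspidal_fourier_expansion f a ->
  exists B, forall tau, upper_half tau -> (Im tau * Cmod (f tau) <= B)%R.
Proof.
  intros hf ha.
  assert (HPI := PI_RGT_0).
  destruct (fourier_terms_bounded f a (1 / 4) ha) as [K HK]; [lra|].
  assert (Hq : (0 < exp (- (PI / 2)) < 1)%R) by (apply exp_lt_1; lra).
  assert (HK0 : (0 <= K)%R).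
  { eapply Rle_trans; [|apply (HK O)].
    apply Rmult_le_pos; [apply Cmod_ge_0|apply Rlt_le, exp_pos]. }
  eexists. apply modular_bound; [exact hf|].
  apply (cusp_bound f a (fun n => K * exp (- (PI / 2)) ^ n)%R
           (K * / (1 - exp (- (PI / 2))))%R ha).
  - intros n.
    replace (- (PI * INR (S n)))%R
      with (- (2 * PI * INR (S n) * (1 / 4)) + - (PI / 2 * INR (S n)))%R by field.
    rewrite exp_plus, <- Rmult_assoc, <- exp_INR_mult.
    apply Rmult_le_compat;
      [apply Rmult_le_pos; [apply Cmod_ge_0|apply Rlt_le, exp_pos]
      |apply Rlt_le, exp_pos|apply HK|].
    apply exp_le. rewrite S_INR. nra.
  - apply is_series_scal_geom. lra.
Qed.

(** Any bound of [Im tau * |f tau|] can be improved by the factor [6/7]: with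
    [n + 1 <= 2^n], [pi <= 4], [e <= 3] and [e^{-pi} <= 1/16], the majorant
    is [1/2 sum_n 24 B 2^n (1/16)^{n+1} = 6/7 B]. *)
Lemma bound_contracts (f : C -> C) (a : nat -> C) (B : R) :
  weakly_modular 2 f -> cuspidal_fourier_expansion f a ->
  (forall tau, upper_half tau -> Im tau * Cmod (f tau) <= B)%R ->
  forall tau, upper_half tau -> (Im tau * Cmod (f tau) <= 6 / 7 * B)%R.
Proof.
  intros hf ha HB.
  assert (HPI := PI_RGT_0). assert (HPI4 := PI_4).
  assert (HB0 : (0 <= B)%R).
  { assert (H := HB (0%R, 1%R) ltac:(unfold upper_half; simpl; lra)).
    generalize (Cmod_ge_0 (f (0%R, 1%R))). simpl Im in H. lra. }
  assert (He : (0 < exp 1 <= 3)%R) by (split; [apply exp_pos|apply exp_le_3]).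
  apply modular_bound; [exact hf|].
  replace (6 / 7 * B)%R with (1 / 2 * (24 * B * (1 / 16) * / (1 - 1 / 8)))%R
    by field.
  apply (cusp_bound f a (fun n => 24 * B * (1 / 16) * (1 / 8) ^ n)%R _ ha).
  - intros n.
    assert (Hq : (exp (- (PI * INR (S n))) <= (1 / 16) ^ S n)%R).
    { replace (- (PI * INR (S n)))%R with (INR (S n) * - PI)%R by ring.
      rewrite exp_INR_mult. apply pow_incr.
      split; [apply Rlt_le, exp_pos|apply exp_opp_PI_le]. }
    assert (Ha : (Cmod (a (S n)) <= 24 * B * 2 ^ n)%R).
    { eapply Rle_trans; [apply (hecke_bound f a B ha HB)|].
      replace (2 * PI * exp 1 * INR (S n) * B)%R
        with (2 * (PI * exp 1) * B * INR (S n))%R by ring.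
      assert (Hpe : (0 <= PI * exp 1 <= 4 * 3)%R)
        by (split; [apply Rmult_le_pos|apply Rmult_le_compat]; lra).
      apply Rmult_le_compat;
        [apply Rmult_le_pos; lra|apply pos_INR| |apply INR_S_le_pow2].
      apply Rmult_le_compat_r; [exact HB0|lra]. }
    replace (24 * B * (1 / 16) * (1 / 8) ^ n)%R
      with (24 * B * 2 ^ n * (1 / 16) ^ S n)%R.
    + apply Rmult_le_compat;
        [apply Cmod_ge_0|apply Rlt_le, exp_pos|exact Ha|exact Hq].
    + replace (1 / 8)%R with (2 * (1 / 16))%R by field.
      rewrite Rpow_mult_distr. simpl. ring.
  - apply is_series_scal_geom. lra.
Qed.

Lemma cusp_form_weight_2_zero (f : C -> C) (a : nat -> C) :
  weakly_modular 2 f -> cuspidal_fourier_expansion f a ->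
  forall tau, upper_half tau -> f tau = 0.
Proof.
  intros hf ha tau Ht.
  destruct (cusp_form_bounded f a hf ha) as [B HB].
  assert (Hn : forall n sigma, upper_half sigma ->
             (Im sigma * Cmod (f sigma) <= (6 / 7) ^ n * B)%R).
  { induction n as [|n IH].
    - intros sigma Hs. simpl. rewrite Rmult_1_l. apply HB, Hs.
    - simpl. setoid_rewrite Rmult_assoc.
      apply (bound_contracts f a _ hf ha IH). }
  assert (Hle : (Im tau * Cmod (f tau) <= 0)%R).
  { refine (is_lim_seq_le (fun _ => (Im tau * Cmod (f tau))%R)
      (fun n => (6 / 7) ^ n * B)%R (Finite _) (Finite 0)
      (fun n => Hn n tau Ht) (is_lim_seq_const _) _).
    replace (Finite 0) with (Rbar_mult 0 B) by (simpl; f_equal; ring).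
    apply is_lim_seq_scal_r. apply is_lim_seq_geom. rewrite Rabs_pos_eq; lra. }
  apply Cmod_eq_0. unfold upper_half in Ht.
  generalize (Cmod_ge_0 (f tau)). nra.
Qed.

(** * The function Phi *)

Lemma CSeries_unique (c : nat -> C) (l : C) :
  is_series (K := C_AbsRing) (V := C_NormedModule) c l -> CSeries c = l.
Proof.
  intros Hc. apply (iota_unique (V := C_CompleteNormedModule)); [|exact Hc].
  intros l' Hl'.
  exact (filterlim_locally_unique (V := C_NormedModule) (F := eventually)
           _ _ _ Hl' Hc).
Qed.

Lemma Phi_eq (f : C -> C) (a : nat -> C) (u : R) :
  cuspidal_fourier_expansion f a ->
  Phi a u = 2 * exp (2 * u) * f (0%R, exp u).
Proof.
  intros ha. unfold Phi. f_equal. apply CSeries_unique.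
  apply (is_series_ext (fun n =>
    a (S n) * Cexp (2 * PI * Ci * INR (S n) * (0%R, exp u)))).
  - intros n. rewrite Cexp_fourier. simpl Im. simpl Re.
    rewrite !Rmult_0_r, expi_0, Cmult_1_r.
    do 3 f_equal. ring.
  - apply ha. apply exp_pos.
Qed.

Theorem mainTheorem5 (f : C -> C) (a : nat -> C) (H : C -> C)
  (hf : cusp_form 2 f)
  (ha : cuspidal_fourier_expansion f a)
  (hH : forall z : C,
     H z = RInt_gen (V := C_R_CompleteNormedModule)
             (fun u : R => (Phi a u * Csinh (z * u))%C)
             (at_point 0%R) (Rbar_locally p_infty)) :
  is_even (Phi a).
Proof.
  destruct hf as [_ [hf _]]. intros u.
  rewrite !(Phi_eq f a _ ha).
  rewrite !(cusp_form_weight_2_zero f a hf ha) by apply exp_pos.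
  ring.
Qed.
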